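(* Let $\mathbb E$ be a cartesian closed category with finite limits. Then the category $\mathrm{Gp}\,\mathbb E$ of internal groups in $\mathbb E$ has normalizers.
   Context: **Normal monomorphisms.** Let $\mathbb C$ be a finitely complete category. For an equivalence relation $(d_0,d_1):R\rightrightarrows X$ in $\mathbb C$, a monomorphism $u:U\rightarrowtail X$ is said to be *normal to* $R$ if: (i) $u^{-1}(R)=\nabla_U$, where $\nabla_U=U\times U$ is the indiscrete equivalence relation on $U$; (ii) the induced internal functor from $\nabla_U$ to $R$, given by $u$ and $\tilde u:U\times U\rightarrowtail R$ with $d_i\circ\tilde u=u\circ p_i$ ($i=0,1$), is a discrete fibration, i.e. these commutative squares are pullbacks. **Normalizers.** A monomorphism $v:U\rightarrowtail T$ in $\mathbb C$ *has a normalizer* when there is a pair $(u,R_v)$, where $u:U\rightarrowtail X$ is a monomorphism normal to the equivalence relation $R_v$ on $X$, together with a map $w:X\rightarrow T$ such that $v=w\circ u$, which is universal among such decompositions: for every equivalence relation $S$ on an object $X'$, every monomorphism $u':U\rightarrowtail X'$ normal to $S$ and every map $h:X'\rightarrow T$ with $v=h\circ u'$, there is a unique map $h':X'\rightarrow X$ such that $w\circ h'=h$, $h'\circ u'=u$ and $h'$ underlies a map of equivalence relations $S\rightarrow R_v$. ($w$ is not assumed to be a monomorphism.) The category $\mathbb C$ *has normalizers* when every monomorphism has a normalizer. *)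

(* Defs.v *)
(* Morphisms of a category are compared with Leibniz equality. *)
From Stdlib Require Import ssreflect ssrfun ssrbool.
From Stdlib Require Import RelationClasses ProofIrrelevance.

Set Implicit Arguments.
Unset Strict Implicit.
Unset Printing Implicit Defensive.

Record Category := {
  obj :> Type;
  hom : obj -> obj -> Type;
  idm : forall A, hom A A;
  comp : forall A B C, hom B C -> hom A B -> hom A C;
  comp_id_l : forall A B (f : hom A B), comp (idm B) f = f;
  comp_id_r : forall A B (f : hom A B), comp f (idm A) = f;
  comp_assoc : forall A B C D (f : hom C D) (g : hom B C) (h : hom A B),
    comp f (comp g h) = comp (comp f g) h }.

Arguments hom {_} _ _.
Arguments idm {_} _.
Arguments comp {_ _ _ _} _ _.

Declare Scope cat_scope.
Delimit Scope cat_scope with cat.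
Local Open Scope cat_scope.
Notation "f ∘ g" := (comp f g) (at level 40, left associativity) : cat_scope.

Definition mono (C : Category) (A B : C) (f : hom A B) : Prop :=
  forall (T : C) (x y : hom T A), f ∘ x = f ∘ y -> x = y.

(*   P --q--> B
     |p       |g
     v        v
     A --f--> D   *)
Definition is_pullback (C : Category) (P A B D : C)
    (p : hom P A) (q : hom P B) (f : hom A D) (g : hom B D) : Prop :=
  f ∘ p = g ∘ q /\
  forall (T : C) (x : hom T A) (y : hom T B), f ∘ x = g ∘ y ->
    exists! t : hom T P, p ∘ t = x /\ q ∘ t = y.

(* Chosen finite limits, presented by a terminal object, binary products and
   equalizers. *)
Record FiniteLimits (C : Category) := {
  one : C;
  bang : forall A : C, hom A one;
  bang_uniq : forall (A : C) (f : hom A one), f = bang A;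
  prod : C -> C -> C;
  fst_ : forall A B : C, hom (prod A B) A;
  snd_ : forall A B : C, hom (prod A B) B;
  pair : forall T A B : C, hom T A -> hom T B -> hom T (prod A B);
  fst_pair : forall (T A B : C) (x : hom T A) (y : hom T B),
    fst_ A B ∘ pair x y = x;
  snd_pair : forall (T A B : C) (x : hom T A) (y : hom T B),
    snd_ A B ∘ pair x y = y;
  pair_uniq : forall (T A B : C) (t : hom T (prod A B)),
    t = pair (fst_ A B ∘ t) (snd_ A B ∘ t);
  eqz : forall A B : C, hom A B -> hom A B -> C;
  eqz_arr : forall (A B : C) (f g : hom A B), hom (eqz f g) A;
  eqz_eq : forall (A B : C) (f g : hom A B), f ∘ eqz_arr f g = g ∘ eqz_arr f g;
  eqz_lift : forall (A B : C) (f g : hom A B) (T : C) (x : hom T A),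
    f ∘ x = g ∘ x -> hom T (eqz f g);
  eqz_liftK : forall (A B : C) (f g : hom A B) (T : C) (x : hom T A)
    (e : f ∘ x = g ∘ x), eqz_arr f g ∘ eqz_lift e = x;
  eqz_mono : forall (A B : C) (f g : hom A B), mono (eqz_arr f g) }.

Arguments one {_} _.
Arguments bang {_} _ _.
Arguments prod {_} _ _ _.
Arguments fst_ {_} _ _ _.
Arguments snd_ {_} _ _ _.
Arguments pair {_} _ {_ _ _} _ _.
Arguments eqz {_} _ {_ _} _ _.
Arguments eqz_arr {_} _ {_ _} _ _.
Arguments eqz_lift {_ _ _ _ _ _ _ _} _.

Section FiniteLimitsTheory.
Variables (C : Category) (L : FiniteLimits C).

Definition prod_map (A B A' B' : C) (f : hom A A') (g : hom B B') :
    hom (prod L A B) (prod L A' B') :=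
  pair L (f ∘ fst_ L A B) (g ∘ snd_ L A B).

Definition prod_assoc (A B D : C) :
    hom (prod L (prod L A B) D) (prod L A (prod L B D)) :=
  pair L (fst_ L A B ∘ fst_ L _ D)
    (pair L (snd_ L A B ∘ fst_ L _ D) (snd_ L _ D)).

Lemma pair_comp (S T A B : C) (x : hom T A) (y : hom T B) (s : hom S T) :
  pair L x y ∘ s = pair L (x ∘ s) (y ∘ s).
Proof. by rewrite [LHS]pair_uniq !comp_assoc fst_pair snd_pair. Qed.

Lemma pair_ext (T A B : C) (s t : hom T (prod L A B)) :
  fst_ L A B ∘ s = fst_ L A B ∘ t -> snd_ L A B ∘ s = snd_ L A B ∘ t -> s = t.
Proof. by move=> e1 e2; rewrite [s]pair_uniq e1 e2 -pair_uniq. Qed.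

Lemma prod_map_pair (T A B A' B' : C) (f : hom A A') (g : hom B B')
    (x : hom T A) (y : hom T B) :
  prod_map f g ∘ pair L x y = pair L (f ∘ x) (g ∘ y).
Proof. by rewrite pair_comp -!comp_assoc fst_pair snd_pair. Qed.

Lemma prod_assoc_pair (T A B D : C) (x : hom T A) (y : hom T B) (z : hom T D) :
  prod_assoc A B D ∘ pair L (pair L x y) z = pair L x (pair L y z).
Proof.
by rewrite /prod_assoc !pair_comp -!comp_assoc !(fst_pair, snd_pair).
Qed.

Lemma bang_comp (S T : C) (s : hom S T) : bang L T ∘ s = bang L S.
Proof. exact: bang_uniq. Qed.

Definition pb (A B D : C) (f : hom A D) (g : hom B D) : C :=
  eqz L (f ∘ fst_ L A B) (g ∘ snd_ L A B).

Definition pb1 (A B D : C) (f : hom A D) (g : hom B D) : hom (pb f g) A :=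
  fst_ L A B ∘ eqz_arr L _ _.

Definition pb2 (A B D : C) (f : hom A D) (g : hom B D) : hom (pb f g) B :=
  snd_ L A B ∘ eqz_arr L _ _.

Lemma pbP (A B D : C) (f : hom A D) (g : hom B D) :
  is_pullback (pb1 f g) (pb2 f g) f g.
Proof.
split; first by rewrite /pb1 /pb2 !comp_assoc eqz_eq.
move=> T x y e.
have e' : f ∘ fst_ L A B ∘ pair L x y = g ∘ snd_ L A B ∘ pair L x y.
  by rewrite -!comp_assoc fst_pair snd_pair.
exists (eqz_lift e'); split.
  by rewrite /pb1 /pb2 -!comp_assoc eqz_liftK fst_pair snd_pair.
move=> t [e1 e2]; apply: (@eqz_mono _ L); rewrite eqz_liftK.
by apply: pair_ext; rewrite ?fst_pair ?snd_pair comp_assoc.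
Qed.

End FiniteLimitsTheory.

Arguments prod_map {_} _ {_ _ _ _} _ _.
Arguments prod_assoc {_} _ _ _ _.
Arguments pb {_} _ {_ _ _} _ _.
Arguments pb1 {_} _ {_ _ _} _ _.
Arguments pb2 {_} _ {_ _ _} _ _.

Record Exponentials (C : Category) (L : FiniteLimits C) := {
  expo : C -> C -> C;
  ev : forall A B : C, hom (prod L (expo A B) A) B;
  curry : forall T A B : C, hom (prod L T A) B -> hom T (expo A B);
  ev_curry : forall (T A B : C) (f : hom (prod L T A) B),
    ev A B ∘ prod_map L (curry f) (idm A) = f;
  curry_uniq : forall (T A B : C) (f : hom (prod L T A) B) (g : hom T (expo A B)),
    ev A B ∘ prod_map L g (idm A) = f -> g = curry f }.

Section EquivalenceRelations.
Variable C : Category.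

(* The relation on generalized elements T -> X represented by (d0, d1). *)
Definition related (R X T : C) (d0 d1 : hom R X) (x y : hom T X) : Prop :=
  exists r : hom T R, d0 ∘ r = x /\ d1 ∘ r = y.

Record EqRel (X : C) := {
  carr :> C;
  d0 : hom carr X;
  d1 : hom carr X;
  jointly_mono : forall (T : C) (r s : hom T carr),
    d0 ∘ r = d0 ∘ s -> d1 ∘ r = d1 ∘ s -> r = s;
  related_equiv : forall T : C, Equivalence (@related carr X T d0 d1) }.

Definition eqrel_map (X X' : C) (S : EqRel X') (R : EqRel X) (h : hom X' X) : Prop :=
  exists k : hom S R, d0 R ∘ k = h ∘ d0 S /\ d1 R ∘ k = h ∘ d1 S.

(* Equality of equivalence relations on X as subobjects of X × X. *)
Definition eqrel_eq (X : C) (R S : EqRel X) : Prop :=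
  eqrel_map R S (idm X) /\ eqrel_map S R (idm X).

End EquivalenceRelations.

Section Normal.
Variables (C : Category) (L : FiniteLimits C).

Definition nabla (U : C) : EqRel U.
Proof.
refine {| carr := prod L U U; d0 := fst_ L U U; d1 := snd_ L U U |}.
- by move=> T r s; apply: pair_ext.
- have rel T (x y : hom T U) : related (fst_ L U U) (snd_ L U U) x y.
    by exists (pair L x y); rewrite fst_pair snd_pair.
  by move=> T; split.
Defined.

(* The pullback of (d0, d1) : R -> X × X along u × u. *)
Section InverseImage.
Variables (X U : C) (u : hom U X) (R : EqRel X).
Let f : hom (prod L U U) (prod L X X) := prod_map L u u.
Let g : hom R (prod L X X) := pair L (d0 R) (d1 R).

Definition inv_im0 : hom (pb L f g) U := fst_ L U U ∘ pb1 L f g.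
Definition inv_im1 : hom (pb L f g) U := snd_ L U U ∘ pb1 L f g.

Lemma inv_im0E : u ∘ inv_im0 = d0 R ∘ pb2 L f g.
Proof.
have := f_equal (comp (fst_ L X X)) (proj1 (pbP L f g)).
by rewrite !comp_assoc /f /g !fst_pair -!comp_assoc.
Qed.

Lemma inv_im1E : u ∘ inv_im1 = d1 R ∘ pb2 L f g.
Proof.
have := f_equal (comp (snd_ L X X)) (proj1 (pbP L f g)).
by rewrite !comp_assoc /f /g !snd_pair -!comp_assoc.
Qed.

Lemma inv_im_related (T : C) (x y : hom T U) :
  related inv_im0 inv_im1 x y <-> related (d0 R) (d1 R) (u ∘ x) (u ∘ y).
Proof.
split=> [[r [<- <-]]|[r [r0 r1]]].
  exists (pb2 L f g ∘ r).
  by rewrite (comp_assoc u) inv_im0E (comp_assoc u) inv_im1E -!comp_assoc.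
have [|t [[t1 t2] _]] := proj2 (pbP L f g) T (pair L x y) r.
  by rewrite /f /g prod_map_pair pair_comp r0 r1.
by exists t; rewrite /inv_im0 /inv_im1 -!(comp_assoc _ (pb1 L f g)) t1 fst_pair snd_pair.
Qed.

Definition inverse_image : EqRel U.
Proof.
refine {| carr := pb L f g; d0 := inv_im0; d1 := inv_im1 |}.
- move=> T r s r0 r1.
  have h1 : pb1 L f g ∘ r = pb1 L f g ∘ s.
    by apply: pair_ext; rewrite !(comp_assoc _ (pb1 L f g)).
  have h2 : pb2 L f g ∘ r = pb2 L f g ∘ s.
    apply: jointly_mono; rewrite !(comp_assoc _ (pb2 L f g)).
      by rewrite -inv_im0E -!(comp_assoc u) r0.
    by rewrite -inv_im1E -!(comp_assoc u) r1.
  have [|t [_ tu]] := proj2 (pbP L f g) T (pb1 L f g ∘ s) (pb2 L f g ∘ s).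
    by rewrite (comp_assoc f) (comp_assoc g) (proj1 (pbP L f g)).
  by rewrite -(tu r) // -(tu s).
- move=> T; have [rf sy tr] := related_equiv R T.
  split.
  + by move=> x; apply/inv_im_related; apply: rf.
  + by move=> x y /inv_im_related h; apply/inv_im_related; apply: sy.
  + move=> x y z /inv_im_related h1 /inv_im_related h2.
    by apply/inv_im_related; apply: tr h1 h2.
Defined.

End InverseImage.

Definition normal_to (U X : C) (u : hom U X) (R : EqRel X) : Prop :=
  mono u /\
  eqrel_eq (inverse_image u R) (nabla U) /\
  exists u' : hom (nabla U) R,
    is_pullback u' (d0 (nabla U)) (d0 R) u /\
    is_pullback u' (d1 (nabla U)) (d1 R) u.

Definition has_normalizer (U T : C) (v : hom U T) : Prop :=
  exists (X : C) (u : hom U X) (Rv : EqRel X) (w : hom X T),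
    normal_to u Rv /\ v = w ∘ u /\
    forall (X' : C) (S : EqRel X') (u' : hom U X') (h : hom X' T),
      normal_to u' S -> v = h ∘ u' ->
      exists! h' : hom X' X, w ∘ h' = h /\ h' ∘ u' = u /\ eqrel_map S Rv h'.

Definition has_normalizers : Prop :=
  forall (U T : C) (v : hom U T), mono v -> has_normalizer v.

End Normal.

Section InternalGroups.
Variables (E : Category) (L : FiniteLimits E).

Record Group := {
  gcarr :> E;
  mul : hom (prod L gcarr gcarr) gcarr;
  unit : hom (one L) gcarr;
  inv : hom gcarr gcarr;
  mul_assoc : mul ∘ prod_map L mul (idm gcarr) =
    mul ∘ prod_map L (idm gcarr) mul ∘ prod_assoc L gcarr gcarr gcarr;
  mul_unit_l : mul ∘ pair L (unit ∘ bang L gcarr) (idm gcarr) = idm gcarr;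
  mul_unit_r : mul ∘ pair L (idm gcarr) (unit ∘ bang L gcarr) = idm gcarr;
  mul_inv_l : mul ∘ pair L inv (idm gcarr) = unit ∘ bang L gcarr;
  mul_inv_r : mul ∘ pair L (idm gcarr) inv = unit ∘ bang L gcarr }.

Definition is_group_hom (G H : Group) (f : hom (gcarr G) (gcarr H)) : Prop :=
  f ∘ mul G = mul H ∘ prod_map L f f.

Record GroupHom (G H : Group) := {
  ghom :> hom (gcarr G) (gcarr H);
  ghomP : is_group_hom ghom }.

Lemma ghom_eq (G H : Group) (f g : GroupHom G H) : ghom f = ghom g -> f = g.
Proof.
case: f g => [f Pf] [g Pg] /= e; rewrite -e in Pg *.
by rewrite (proof_irrelevance _ Pf Pg).
Qed.

Definition gid (G : Group) : GroupHom G G.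
Proof.
exists (idm (gcarr G)).
by rewrite /is_group_hom comp_id_l /prod_map !comp_id_l -(comp_id_r (fst_ _ _ _))
  -(comp_id_r (snd_ _ _ _)) -pair_uniq comp_id_r.
Defined.

Definition gcomp (G H K : Group) (f : GroupHom H K) (g : GroupHom G H) : GroupHom G K.
Proof.
exists (ghom f ∘ ghom g).
by rewrite /is_group_hom -comp_assoc ghomP comp_assoc ghomP -comp_assoc
  prod_map_pair !comp_assoc.
Defined.

Definition Gp : Category.
Proof.
refine {| obj := Group; hom := GroupHom; idm := gid; comp := gcomp |}.
- by move=> A B f; apply: ghom_eq; apply: comp_id_l.
- by move=> A B f; apply: ghom_eq; apply: comp_id_r.
- by move=> A B K D f g h; apply: ghom_eq; apply: comp_assoc.
Defined.

(* The group laws for generalized elements T -> X, for all T. *)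
Section Elements.
Variables (X : E) (m : hom (prod L X X) X) (e : hom (one L) X) (i : hom X X).

Definition group_laws : Prop := forall (T : E),
  (forall x y z : hom T X,
    m ∘ pair L (m ∘ pair L x y) z = m ∘ pair L x (m ∘ pair L y z)) /\
  (forall x : hom T X,
    [/\ m ∘ pair L (e ∘ bang L T) x = x, m ∘ pair L x (e ∘ bang L T) = x,
        m ∘ pair L (i ∘ x) x = e ∘ bang L T & m ∘ pair L x (i ∘ x) = e ∘ bang L T]).

Definition mk_group (laws : group_laws) : Group.
Proof.
refine {| gcarr := X; mul := m; unit := e; inv := i |}.
- have [mA _] := laws (prod L (prod L X X) X).
  rewrite -(comp_assoc m) /prod_assoc prod_map_pair comp_id_l.
  rewrite /prod_map comp_id_l -mA; congr (m ∘ pair L (m ∘ _) _).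
  exact: pair_uniq.
- by have [_ /(_ (idm X)) []] := laws X.
- by have [_ /(_ (idm X)) []] := laws X.
- by have [_ /(_ (idm X)) []] := laws X; rewrite comp_id_r.
- by have [_ /(_ (idm X)) []] := laws X; rewrite comp_id_r.
Defined.

End Elements.

Lemma groupP (G : Group) : group_laws (mul G) (unit G) (inv G).
Proof.
move=> T; split=> [x y z|x].
  have /= := f_equal (fun t => t ∘ pair L (pair L x y) z) (mul_assoc G).
  by rewrite -!comp_assoc prod_assoc_pair !prod_map_pair !comp_id_l.
split.
- have /= := f_equal (fun t => t ∘ x) (mul_unit_l G).
  by rewrite -!comp_assoc pair_comp -!comp_assoc bang_comp !comp_id_l.
- have /= := f_equal (fun t => t ∘ x) (mul_unit_r G).
  by rewrite -!comp_assoc pair_comp -!comp_assoc bang_comp !comp_id_l.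
- have /= := f_equal (fun t => t ∘ x) (mul_inv_l G).
  by rewrite -!comp_assoc pair_comp bang_comp !comp_id_l.
- have /= := f_equal (fun t => t ∘ x) (mul_inv_r G).
  by rewrite -!comp_assoc pair_comp bang_comp !comp_id_l.
Qed.

Lemma ghom_pair (G H : Group) (f : GroupHom G H) (T : E) (x y : hom T (gcarr G)) :
  ghom f ∘ (mul G ∘ pair L x y) = mul H ∘ pair L (ghom f ∘ x) (ghom f ∘ y).
Proof. by rewrite comp_assoc ghomP -comp_assoc prod_map_pair. Qed.

Lemma mulg_cancel (G : Group) (T : E) (x y z : hom T (gcarr G)) :
  mul G ∘ pair L x y = mul G ∘ pair L x z -> y = z.
Proof.
move=> e; have [mA /(_ x) [_ _ Vx _]] := groupP G T.
have := f_equal (fun t => mul G ∘ pair L (inv G ∘ x) t) e.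
rewrite /= -!mA Vx.
by have [_ /(_ y) [-> _ _ _]] := groupP G T; have [_ /(_ z) [-> _ _ _]] := groupP G T.
Qed.

Lemma ghom_unit (G H : Group) (f : GroupHom G H) : ghom f ∘ unit G = unit H.
Proof.
have b1 : bang L (one L) = idm (one L) by apply: esym; apply: bang_uniq.
have [_ /(_ (unit G)) [eG _ _ _]] := groupP G (one L).
have [_ /(_ (ghom f ∘ unit G)) [_ eH _ _]] := groupP H (one L).
apply: (@mulg_cancel H _ (ghom f ∘ unit G)).
rewrite -ghom_pair; move: eG eH; rewrite b1 !comp_id_r => -> -> //.
Qed.

Lemma ghom_inv (G H : Group) (f : GroupHom G H) : ghom f ∘ inv G = inv H ∘ ghom f.
Proof.
have [_ /(_ (ghom f)) [_ _ _ eH]] := groupP H (gcarr G).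
have [_ /(_ (idm _)) [_ _ _ eG]] := groupP G (gcarr G).
apply: (@mulg_cancel H _ (ghom f)); rewrite eH.
have := ghom_pair f (idm _) (inv G ∘ idm _).
by rewrite eG !comp_id_r comp_assoc ghom_unit => <-.
Qed.

Definition gone : Group.
Proof.
apply: (@mk_group (one L) (bang L _) (idm _) (idm _)).
have eqb T (f g : hom T (one L)) : f = g by rewrite (bang_uniq f) (bang_uniq g).
by move=> T; split=> *; [exact: eqb | split; exact: eqb].
Defined.

Definition gbang (G : Group) : GroupHom G gone.
Proof.
exists (bang L (gcarr G)).
by rewrite /is_group_hom /= !bang_comp.
Defined.

Section Product.
Variables G H : Group.
Let P := prod L (gcarr G) (gcarr H).
Let p : hom P (gcarr G) := fst_ L (gcarr G) (gcarr H).
Let q : hom P (gcarr H) := snd_ L (gcarr G) (gcarr H).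

Definition prod_mul : hom (prod L P P) P :=
  pair L (mul G ∘ prod_map L p p) (mul H ∘ prod_map L q q).

Lemma prod_mulE (T : E) (x y : hom T P) : prod_mul ∘ pair L x y =
  pair L (mul G ∘ pair L (p ∘ x) (p ∘ y)) (mul H ∘ pair L (q ∘ x) (q ∘ y)).
Proof. by rewrite /prod_mul pair_comp -!(comp_assoc (mul _)) !prod_map_pair. Qed.

Definition gprod : Group.
Proof.
apply: (@mk_group P prod_mul (pair L (unit G) (unit H))
  (pair L (inv G ∘ p) (inv H ∘ q))).
move=> T; have [AG IG] := groupP G T; have [AH IH] := groupP H T.
split=> [x y z|x].
  by rewrite !prod_mulE /p /q !fst_pair !snd_pair AG AH.
have [G1 G2 G3 G4] := IG (p ∘ x); have [H1 H2 H3 H4] := IH (q ∘ x).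
by split; rewrite prod_mulE !pair_comp /p /q !fst_pair !snd_pair
  -?(comp_assoc (inv _)) ?G1 ?G2 ?G3 ?G4 ?H1 ?H2 ?H3 ?H4 -?pair_uniq.
Defined.

Definition gfst : GroupHom gprod G.
Proof. by exists p; rewrite /is_group_hom /= /prod_mul /p fst_pair. Defined.

Definition gsnd : GroupHom gprod H.
Proof. by exists q; rewrite /is_group_hom /= /prod_mul /q snd_pair. Defined.

Definition gpair (K : Group) (f : GroupHom K G) (g : GroupHom K H) : GroupHom K gprod.
Proof.
exists (pair L (ghom f) (ghom g)).
rewrite /is_group_hom /= pair_comp !ghomP /prod_map prod_mulE /p /q.
by rewrite !(comp_assoc (fst_ L (gcarr G) _)) !(comp_assoc (snd_ L (gcarr G) _))
  !fst_pair !snd_pair.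
Defined.

End Product.

Section Equalizer.
Variables (G H : Group) (f g : GroupHom G H).
Let X := eqz L (ghom f) (ghom g).
Let k : hom X (gcarr G) := eqz_arr L (ghom f) (ghom g).

Lemma eqz_mul_eq : ghom f ∘ (mul G ∘ prod_map L k k) = ghom g ∘ (mul G ∘ prod_map L k k).
Proof. by rewrite !ghom_pair !(comp_assoc _ k) /k eqz_eq. Qed.

Lemma eqz_unit_eq : ghom f ∘ unit G = ghom g ∘ unit G.
Proof. by rewrite !ghom_unit. Qed.

Lemma eqz_inv_eq : ghom f ∘ (inv G ∘ k) = ghom g ∘ (inv G ∘ k).
Proof. by rewrite !(comp_assoc _ (inv G)) !ghom_inv -!(comp_assoc (inv H)) /k eqz_eq. Qed.

Definition geqz : Group.
Proof.
apply: (@mk_group X (eqz_lift eqz_mul_eq) (eqz_lift eqz_unit_eq) (eqz_lift eqz_inv_eq)).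
have mE (T : E) (x y : hom T X) :
    k ∘ (eqz_lift eqz_mul_eq ∘ pair L x y) = mul G ∘ pair L (k ∘ x) (k ∘ y).
  by rewrite (comp_assoc k) /k eqz_liftK -comp_assoc prod_map_pair.
have eE (T : E) : k ∘ (eqz_lift eqz_unit_eq ∘ bang L T) = unit G ∘ bang L T.
  by rewrite (comp_assoc k) /k eqz_liftK.
have iE (T : E) (x : hom T X) : k ∘ (eqz_lift eqz_inv_eq ∘ x) = inv G ∘ (k ∘ x).
  by rewrite (comp_assoc k) /k eqz_liftK -comp_assoc.
move=> T; have [AG IG] := groupP G T; split=> [x y z|x].
  by apply: (@eqz_mono _ L); rewrite -/k !mE AG.
have [G1 G2 G3 G4] := IG (k ∘ x).
by split; apply: (@eqz_mono _ L); rewrite -/k ?mE ?eE ?iE.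
Defined.

Definition geqz_arr : GroupHom geqz G.
Proof. by exists k; rewrite /is_group_hom /= /k eqz_liftK. Defined.

Lemma gcomp_eq (K : Group) (h : GroupHom K G) :
  gcomp f h = gcomp g h -> ghom f ∘ ghom h = ghom g ∘ ghom h.
Proof. exact: (f_equal (@ghom K H)). Qed.

Definition geqz_lift (K : Group) (h : GroupHom K G) (e : gcomp f h = gcomp g h) :
  GroupHom K geqz.
Proof.
exists (eqz_lift (gcomp_eq e)); apply: (@eqz_mono _ L).
rewrite comp_assoc eqz_liftK ghomP (comp_assoc (eqz_arr _ _ _)) eqz_liftK.
by rewrite -comp_assoc prod_map_pair !(comp_assoc k) /k eqz_liftK.
Defined.

End Equalizer.

Definition Gp_limits : FiniteLimits Gp.
Proof.
refine (@Build_FiniteLimits Gp gone gbang _ gprod gfst gsnd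
  (fun T A B => @gpair A B T) _ _ _ geqz geqz_arr _
  (fun A B f g T x => @geqz_lift A B f g T x) _ _).
- by move=> G f; apply: ghom_eq; apply: bang_uniq.
- by move=> T A B x y; apply: ghom_eq; apply: fst_pair.
- by move=> T A B x y; apply: ghom_eq; apply: snd_pair.
- by move=> T A B t; apply: ghom_eq; apply: pair_uniq.
- by move=> A B f g; apply: ghom_eq; apply: eqz_eq.
- by move=> A B f g T x e; apply: ghom_eq; apply: eqz_liftK.
- by move=> A B f g T x y e; apply: ghom_eq; apply: (@eqz_mono _ L);
    apply: (f_equal (@ghom _ _) e).
Defined.

End InternalGroups.

(* Main.v *)
From Stdlib Require Import ssreflect ssrfun ssrbool.
From Stdlib Require Import RelationClasses Setoid.
Require Import Defs.

Set Implicit Arguments.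
Unset Strict Implicit.
Unset Printing Implicit Defensive.

Local Open Scope cat_scope.

(** For a subgroup [v : U → G] of a group of sets, the normalizer is
    [N = {a | a U a^-1 ⊆ U and a^-1 U a ⊆ U}] with the congruence
    [a ~ b iff a^-1 b ∈ U]. If [U] is also normal in [X'] and [h : X' → G]
    extends [v], then [h a] conjugates [U] into itself because [a] does, so [h]
    factors through [N].

    The same argument works internally, read on generalized elements. Three
    facts make this possible.

    - The condition defining [N] quantifies over all elements of [U]. A
      universal quantifier over [U] is represented by a subobject as soon as the
      exponentials by [U] exist: [m ∘ _ : S^U → B^U] is mono when [m] is, and
      one pulls it back along the transpose of the map in question
      ([forall_representable]). This is the only use of cartesian closedness.
    - A subobject whose generalized elements are closed under the group
      operations is a subgroup ([subgroup_of_mono]), and a homomorphism whose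
      underlying arrow factors through a subgroup factors as a homomorphism
      ([ghom_lift]).
    - The hypotheses of the universal property (monomorphism, normality) speak
      of the category of groups, hence only of homomorphisms out of groups. They
      pass to elements [T → X] with [T] an arbitrary object of the base, because
      limits of groups are computed on underlying objects ([mono_ghom],
      [pullback_element]).

    Normality in the sense of equivalence relations then amounts to the usual
    one. If [u] is normal to [S], then [x S y] gives [x^-1 y ∈ u]
    ([normal_div]) and [u] is stable under conjugation ([normal_conj]);
    conversely, a subgroup stable under conjugation is normal to the relation
    [x^-1 y ∈ u] ([congruence_eqrel]). *)

(** * Membership of generalized elements in a subobject *)

Definition member (C : Category) (S A : C) (m : hom S A) (T : C) (x : hom T A) : Prop :=
  exists s : hom T S, m ∘ s = x.

Lemma member_comp (C : Category) (S A T T' : C) (m : hom S A) (x : hom T A)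
    (s : hom T' T) :
  member m x -> member m (x ∘ s).
Proof. by case=> y <-; exists (y ∘ s); rewrite comp_assoc. Qed.

Lemma member_id (C : Category) (S A : C) (m : hom S A) : member m m.
Proof. by exists (idm S); rewrite comp_id_r. Qed.

Section Subobjects.
Variables (E : Category) (L : FiniteLimits E).

Lemma mono_pb1 (A B D : E) (f : hom A D) (g : hom B D) : mono g -> mono (pb1 L f g).
Proof.
move=> gm T x y e; have [c u] := pbP L f g.
have [|t [_ tu]] := u T (pb1 L f g ∘ x) (pb2 L f g ∘ x).
  by rewrite (comp_assoc f) c comp_assoc.
rewrite -(tu x) //; apply: tu; split=> //.
by apply: gm; rewrite (comp_assoc g _ x) (comp_assoc g _ y) -c -!(comp_assoc f) e.
Qed.

Lemma member_pb1 (A B D : E) (f : hom A D) (g : hom B D) (T : E) (a : hom T A) :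
  member (pb1 L f g) a <-> member g (f ∘ a).
Proof.
have [c u] := pbP L f g; split=> [[s <-]|[b e]].
  by exists (pb2 L f g ∘ s); rewrite (comp_assoc g) (comp_assoc f) c.
by have [t [[<- _] _]] := u T a b (esym e); exists t.
Qed.

Lemma mono_prod_map (A B A' B' : E) (f : hom A A') (g : hom B B') :
  mono f -> mono g -> mono (prod_map L f g).
Proof.
move=> fm gm T x y e; apply: pair_ext.
  apply: fm; have := f_equal (comp (fst_ L _ _)) e.
  by rewrite /prod_map !pair_comp !fst_pair -!comp_assoc.
apply: gm; have := f_equal (comp (snd_ L _ _)) e.
by rewrite /prod_map !pair_comp !snd_pair -!comp_assoc.
Qed.

Lemma member_prod_map (A B A' B' : E) (f : hom A A') (g : hom B B')
    (T : E) (x : hom T A') (y : hom T B') :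
  member (prod_map L f g) (pair L x y) <-> member f x /\ member g y.
Proof.
split=> [[s e]|[[a <-] [b <-]]]; last by exists (pair L a b); rewrite prod_map_pair.
split.
  exists (fst_ L _ _ ∘ s); have := f_equal (comp (fst_ L _ _)) e.
  by rewrite /prod_map pair_comp !fst_pair comp_assoc.
exists (snd_ L _ _ ∘ s); have := f_equal (comp (snd_ L _ _)) e.
by rewrite /prod_map pair_comp !snd_pair comp_assoc.
Qed.

Section Universal.
Variable X : Exponentials L.

Definition uncurry (T A B : E) (g : hom T (expo X A B)) : hom (prod L T A) B :=
  ev X A B ∘ prod_map L g (idm A).

Lemma uncurryK (T A B : E) (g : hom T (expo X A B)) : curry X (uncurry g) = g.
Proof. by apply: esym; apply: curry_uniq. Qed.

Lemma uncurry_comp (T T' A B : E) (g : hom T (expo X A B)) (s : hom T' T) :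
  uncurry (g ∘ s) = uncurry g ∘ prod_map L s (idm A).
Proof.
rewrite /uncurry -comp_assoc {3}/prod_map prod_map_pair.
by rewrite /prod_map !comp_id_l comp_assoc.
Qed.

Definition exp_map (A B B' : E) (m : hom B B') : hom (expo X A B) (expo X A B') :=
  curry X (m ∘ ev X A B).

Lemma uncurry_exp_map (T A B B' : E) (m : hom B B') (g : hom T (expo X A B)) :
  uncurry (exp_map A m ∘ g) = m ∘ uncurry g.
Proof. by rewrite uncurry_comp {1}/uncurry ev_curry -comp_assoc. Qed.

Lemma mono_exp_map (A B B' : E) (m : hom B B') : mono m -> mono (exp_map A m).
Proof.
move=> mm T x y e; rewrite -(uncurryK x) -(uncurryK y); congr (curry X _).
by apply: mm; rewrite -!uncurry_exp_map e.
Qed.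

(** Represents [{a | f(a, x) ∈ S for every x : U}]. Quantifying over all stages
    [s : T' → T] is the same as testing the generic element [snd] at the stage
    [T × U], and a factorization of [f ∘ (a × U)] through [m] is, after currying,
    an arrow [T → S^U] over [B^U]. *)
Lemma forall_representable (A U B S : E) (f : hom (prod L A U) B) (m : hom S B) :
  mono m ->
  exists (N : E) (n : hom N A), mono n /\
    forall (T : E) (a : hom T A), member n a <->
      forall (T' : E) (s : hom T' T) (x : hom T' U), member m (f ∘ pair L (a ∘ s) x).
Proof.
move=> mm; exists (pb L (curry X f) (exp_map U m)), (pb1 L (curry X f) (exp_map U m)).
split; first exact/mono_pb1/mono_exp_map.
move=> T a; rewrite member_pb1; split=> [[b e] T' s x|h].
  exists (uncurry b ∘ pair L s x).
  rewrite comp_assoc -uncurry_exp_map e uncurry_comp /uncurry ev_curry.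
  by rewrite -comp_assoc prod_map_pair comp_id_l.
have [t e] := h _ (fst_ L T U) (snd_ L T U).
exists (curry X t); rewrite -[LHS]uncurryK -[RHS]uncurryK; congr (curry X _).
rewrite uncurry_exp_map uncurry_comp /uncurry !ev_curry e.
by rewrite /prod_map comp_id_l.
Qed.

End Universal.
End Subobjects.

(** * Calculus of generalized elements of a group *)

Section GroupElements.
Variables (E : Category) (L : FiniteLimits E).

Definition mulg (G : Group L) (T : E) (x y : hom T (gcarr G)) : hom T (gcarr G) :=
  mul G ∘ pair L x y.
Definition invg (G : Group L) (T : E) (x : hom T (gcarr G)) : hom T (gcarr G) :=
  inv G ∘ x.
Definition oneg (G : Group L) (T : E) : hom T (gcarr G) := unit G ∘ bang L T.

Local Notation "x ⋅ y" := (mulg x y) (at level 40, left associativity).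
Local Notation "x ^-1" := (invg x) (at level 3, format "x ^-1").

Definition conjg (G : Group L) (T : E) (a x : hom T (gcarr G)) := a ⋅ x ⋅ a^-1.

Section Laws.
Variables (G : Group L) (T : E).
Implicit Types x y z : hom T (gcarr G).

Lemma mulgA x y z : (x ⋅ y) ⋅ z = x ⋅ (y ⋅ z).
Proof. exact: (proj1 (groupP G T)). Qed.
Lemma mul1g x : oneg G T ⋅ x = x.
Proof. by have [_ /(_ x) []] := groupP G T. Qed.
Lemma mulg1 x : x ⋅ oneg G T = x.
Proof. by have [_ /(_ x) []] := groupP G T. Qed.
Lemma mulVg x : x^-1 ⋅ x = oneg G T.
Proof. by have [_ /(_ x) []] := groupP G T. Qed.
Lemma mulgV x : x ⋅ x^-1 = oneg G T.
Proof. by have [_ /(_ x) []] := groupP G T. Qed.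
Lemma mulKg x y : x^-1 ⋅ (x ⋅ y) = y.
Proof. by rewrite -mulgA mulVg mul1g. Qed.
Lemma mulVKg x y : x ⋅ (x^-1 ⋅ y) = y.
Proof. by rewrite -mulgA mulgV mul1g. Qed.
Lemma invg_unique x y : x ⋅ y = oneg G T -> x^-1 = y.
Proof. by move=> e; rewrite -[LHS]mulg1 -e mulKg. Qed.
Lemma invgK x : x^-1^-1 = x.
Proof. by apply: invg_unique; rewrite mulVg. Qed.
Lemma invg1 : (oneg G T)^-1 = oneg G T.
Proof. by apply: invg_unique; rewrite mulg1. Qed.
Lemma invgM x y : (x ⋅ y)^-1 = y^-1 ⋅ x^-1.
Proof. by apply: invg_unique; rewrite mulgA mulVKg mulgV. Qed.
End Laws.

(** The complete rewriting system of the theory of groups: two group words that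
    are provably equal have the same normal form. *)
Definition gsimp :=
  (mul1g, mulg1, mulVg, mulgV, mulKg, mulVKg, invgK, invg1, invgM, mulgA).

Lemma mulg_comp (G : Group L) (T T' : E) (x y : hom T (gcarr G)) (s : hom T' T) :
  (x ⋅ y) ∘ s = (x ∘ s) ⋅ (y ∘ s).
Proof. by rewrite /mulg -comp_assoc pair_comp. Qed.

Lemma invg_comp (G : Group L) (T T' : E) (x : hom T (gcarr G)) (s : hom T' T) :
  x^-1 ∘ s = (x ∘ s)^-1.
Proof. by rewrite /invg comp_assoc. Qed.

Lemma oneg_comp (G : Group L) (T T' : E) (s : hom T' T) : oneg G T ∘ s = oneg G T'.
Proof. by rewrite /oneg -comp_assoc bang_comp. Qed.

Lemma conjg_comp (G : Group L) (T T' : E) (a x : hom T (gcarr G)) (s : hom T' T) :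
  conjg a x ∘ s = conjg (a ∘ s) (x ∘ s).
Proof. by rewrite /conjg !mulg_comp invg_comp. Qed.

Section Hom.
Variables (G H : Group L) (f : GroupHom G H) (T : E).
Implicit Types x y : hom T (gcarr G).

Lemma ghomM x y : ghom f ∘ (x ⋅ y) = (ghom f ∘ x) ⋅ (ghom f ∘ y).
Proof. exact: ghom_pair. Qed.
Lemma ghomV x : ghom f ∘ x^-1 = (ghom f ∘ x)^-1.
Proof. by rewrite /invg comp_assoc ghom_inv comp_assoc. Qed.
Lemma ghom1 : ghom f ∘ oneg G T = oneg H T.
Proof. by rewrite /oneg comp_assoc ghom_unit. Qed.
Lemma ghomJ a x : ghom f ∘ conjg a x = conjg (ghom f ∘ a) (ghom f ∘ x).
Proof. by rewrite /conjg !ghomM ghomV. Qed.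
End Hom.

Lemma is_group_homP (G H : Group L) (f : hom (gcarr G) (gcarr H)) :
  (forall (T : E) (x y : hom T (gcarr G)), f ∘ (x ⋅ y) = (f ∘ x) ⋅ (f ∘ y)) ->
  is_group_hom f.
Proof.
move=> h; rewrite /is_group_hom; have := h _ (fst_ L _ _) (snd_ L _ _).
by rewrite /mulg -(comp_id_r (fst_ L _ _)) -(comp_id_r (snd_ L _ _)) -pair_uniq !comp_id_r.
Qed.

(** * Subgroups and homomorphisms given by generalized elements *)

(** The factorization is automatically multiplicative, since [m] is mono. *)
Lemma ghom_lift (S G K : Group L) (m : GroupHom S G) (f : GroupHom K G) :
  mono (ghom m) -> member (ghom m) (ghom f) -> exists k : GroupHom K S, gcomp m k = f.
Proof.
move=> mm [k e].
have kP : is_group_hom k.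
  apply: is_group_homP => T x y; apply: mm.
  by rewrite ghomM !(comp_assoc (ghom m)) e ghomM.
by exists (Build_GroupHom kP); apply: ghom_eq.
Qed.

(** Closure at the generic elements, the projections [S × S → S] and the identity
    of [S], supplies the operations; the laws are inherited since [m] is mono. *)
Lemma subgroup_of_mono (G : Group L) (S : E) (m : hom S (gcarr G)) :
  mono m ->
  (forall T (x y : hom T (gcarr G)), member m x -> member m y -> member m (x ⋅ y)) ->
  (forall T, member m (oneg G T)) ->
  (forall T (x : hom T (gcarr G)), member m x -> member m (x^-1)) ->
  exists (H : Group L) (i : GroupHom H G), mono (ghom i) /\
    forall T (x : hom T (gcarr G)), member (ghom i) x <-> member m x.
Proof.
move=> mm cM c1 cV.
have [mu muE] : member m ((m ∘ fst_ L S S) ⋅ (m ∘ snd_ L S S)).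
  by apply: cM; apply: member_comp; apply: member_id.
have [e eE] := c1 (one L).
have [i iE] := cV _ _ (member_id m).
have muP T (x y : hom T S) : m ∘ (mu ∘ pair L x y) = (m ∘ x) ⋅ (m ∘ y).
  by rewrite comp_assoc muE mulg_comp -!comp_assoc fst_pair snd_pair.
have eP T : m ∘ (e ∘ bang L T) = oneg G T.
  by rewrite comp_assoc eE oneg_comp.
have iP T (x : hom T S) : m ∘ (i ∘ x) = (m ∘ x)^-1.
  by rewrite comp_assoc iE invg_comp.
have laws : group_laws (L := L) mu e i.
  move=> T; split=> [x y z|x]; first by apply: mm; rewrite !muP mulgA.
  by split; apply: mm; rewrite ?muP ?eP ?iP ?gsimp.
have hP : @is_group_hom _ _ (mk_group laws) G m by apply: is_group_homP.
by exists (mk_group laws), (Build_GroupHom hP).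
Qed.

(** * Limits of groups are computed on underlying objects *)

Lemma pb_element (A B D : Group L) (f : GroupHom A D) (g : GroupHom B D) (T : E)
    (x : hom T (gcarr A)) (y : hom T (gcarr B)) :
  ghom f ∘ x = ghom g ∘ y ->
  exists z : hom T (gcarr (pb (Gp_limits L) (f : @hom (Gp L) A D) g)),
    ghom (pb1 (Gp_limits L) (f : @hom (Gp L) A D) g) ∘ z = x /\
    ghom (pb2 (Gp_limits L) (f : @hom (Gp L) A D) g) ∘ z = y.
Proof.
move=> e; have [z [[z1 z2] _]] := proj2 (pbP L (ghom f) (ghom g)) T x y e.
by exists z.
Qed.

(** The forgetful functor preserves pullbacks: any pullback of groups receives a
    map from the chosen one, whose underlying object is a pullback in the base. *)
Lemma pullback_element (P A B D : Gp L) (p : hom P A) (q : hom P B)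
    (f : hom A D) (g : hom B D) (T : E) (x : hom T (gcarr A)) (y : hom T (gcarr B)) :
  is_pullback p q f g -> ghom f ∘ x = ghom g ∘ y ->
  exists z : hom T (gcarr P), ghom p ∘ z = x /\ ghom q ∘ z = y.
Proof.
move=> [_ u] /pb_element [z [<- <-]].
have [t [[<- <-] _]] := u _ _ _ (proj1 (pbP (Gp_limits L) f g)).
by exists (ghom t ∘ z); rewrite !comp_assoc.
Qed.

(** The two projections of the kernel pair of [f], taken in groups, are equal,
    and [(x, y)] is a generalized element of it. *)
Lemma mono_ghom (G H : Gp L) (f : hom G H) : mono f -> mono (ghom f).
Proof.
move=> fm T x y /pb_element [z [<- <-]].
by rewrite (fm _ _ _ (proj1 (pbP (Gp_limits L) f f))).
Qed.

Lemma mono_of_ghom (G H : Gp L) (f : hom G H) : mono (ghom f) -> mono f.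
Proof.
move=> fm T x y e; apply: ghom_eq; apply: fm.
exact: (f_equal (@ghom _ _ _ _) e).
Qed.

(** * Normal monomorphisms and normal subgroups *)

(** The discrete fibration condition says that an element [S]-related to one of
    [U] lies in [U]. *)
Section NormalElements.
Variables (U X : Gp L) (u : hom U X) (S : EqRel X).
Hypothesis nu : normal_to (Gp_limits L) u S.

(** Left translation by [x^-1], carried out inside [S] through the diagonal
    [e : X → S], turns a pair [(x, y)] of [S] into [(1, x^-1 y)]; as [1] lies in
    [U], so does [x^-1 y]. *)
Lemma normal_div (T : E) (r : hom T (gcarr (carr S))) :
  member (ghom u) ((ghom (d0 S) ∘ r)^-1 ⋅ (ghom (d1 S) ∘ r)).
Proof.
have [_ [_ [u' [pb0 pb1]]]] := nu.
have [e [e0 e1]] := @Equivalence_Reflexive _ _ (related_equiv S X) (idm X).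
have e0E : ghom (d0 S) ∘ ghom e = idm _ := f_equal (@ghom _ _ _ _) e0.
have e1E : ghom (d1 S) ∘ ghom e = idm _ := f_equal (@ghom _ _ _ _) e1.
pose r' := (ghom e ∘ (ghom (d0 S) ∘ r))^-1 ⋅ r.
have r0 : ghom (d0 S) ∘ r' = ghom u ∘ oneg U T.
  rewrite /r' ghomM ghomV ghom1 (comp_assoc _ (ghom e)) e0E comp_id_l.
  by rewrite mulVg.
have [z [zr _]] := pullback_element pb0 r0.
exists (ghom (d1 (nabla (Gp_limits L) U)) ∘ z).
have c : ghom (d1 S) ∘ ghom u' = ghom u ∘ ghom (d1 (nabla (Gp_limits L) U)) :=
  f_equal (@ghom _ _ _ _) (proj1 pb1).
rewrite comp_assoc -c -comp_assoc zr /r' ghomM ghomV (comp_assoc _ (ghom e)) e1E.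
by rewrite comp_id_l.
Qed.

(** The pair [(a^-1, u(x) a^-1)] belongs to [S], being the product of [(1, u(x))]
    and [(a^-1, a^-1)]; its quotient is the conjugate. *)
Lemma normal_conj (T : E) (a : hom T (gcarr X)) (x : hom T (gcarr U)) :
  member (ghom u) (conjg a (ghom u ∘ x)).
Proof.
have [_ [_ [u' [pb0 pb1]]]] := nu.
have [e [e0 e1]] := @Equivalence_Reflexive _ _ (related_equiv S X) (idm X).
have e0E : ghom (d0 S) ∘ ghom e = idm _ := f_equal (@ghom _ _ _ _) e0.
have e1E : ghom (d1 S) ∘ ghom e = idm _ := f_equal (@ghom _ _ _ _) e1.
have c0 : ghom (d0 S) ∘ ghom u' = ghom u ∘ fst_ L _ _ :=
  f_equal (@ghom _ _ _ _) (proj1 pb0).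
have c1 : ghom (d1 S) ∘ ghom u' = ghom u ∘ snd_ L _ _ :=
  f_equal (@ghom _ _ _ _) (proj1 pb1).
have := normal_div ((ghom u' ∘ pair L (oneg U T) x) ⋅ (ghom e ∘ a^-1)).
rewrite !ghomM !(comp_assoc _ (ghom e)) e0E e1E !comp_id_l.
rewrite !(comp_assoc _ (ghom u')) c0 c1 -!(comp_assoc (ghom u)) fst_pair snd_pair.
by rewrite ghom1 /conjg !gsimp.
Qed.

End NormalElements.

Section Congruence.
Variables (U N : Gp L) (u : hom U N).
Hypothesis um : mono (ghom u).
Hypothesis uJ : forall (T : E) (a : hom T (gcarr N)) (x : hom T (gcarr U)),
  member (ghom u) (conjg a (ghom u ∘ x)).

Let memM (T : E) (x y : hom T (gcarr N)) :
  member (ghom u) x -> member (ghom u) y -> member (ghom u) (x ⋅ y).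
Proof. by move=> [s <-] [t <-]; exists (s ⋅ t); rewrite ghomM. Qed.

Let memV (T : E) (x : hom T (gcarr N)) : member (ghom u) x -> member (ghom u) (x^-1).
Proof. by move=> [s <-]; exists (s^-1); rewrite ghomV. Qed.

Let mem1 (T : E) : member (ghom u) (oneg N T).
Proof. by exists (oneg U T); rewrite ghom1. Qed.

Let memJ (T : E) (a x : hom T (gcarr N)) :
  member (ghom u) x -> member (ghom u) (conjg a x).
Proof. by move=> [s <-]; apply: uJ. Qed.

Let P : Group L := gprod N N.
Let p : GroupHom P N := gfst N N.
Let q : GroupHom P N := gsnd N N.

(** Closure of the relation under products and inverses of pairs is where the
    stability of [U] under conjugation enters. *)
Lemma congruence_subgroup : exists (R : Group L) (i : GroupHom R P), mono (ghom i) /\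
  forall T (x : hom T (gcarr P)),
    member (ghom i) x <-> member (ghom u) ((ghom p ∘ x)^-1 ⋅ (ghom q ∘ x)).
Proof.
pose f := (ghom p)^-1 ⋅ ghom q.
have fE T (x : hom T (gcarr P)) : f ∘ x = (ghom p ∘ x)^-1 ⋅ (ghom q ∘ x).
  by rewrite /f mulg_comp invg_comp.
have [||||R [i [im iE]]] := @subgroup_of_mono P _ (pb1 L f (ghom u)).
- exact: mono_pb1.
- move=> T x y; rewrite !member_pb1 !fE !ghomM => hx hy.
  (* With x = (a, b) and y = (a', b'):
     (a a')^-1 (b b') = a'^-1 (a^-1 b) a' · a'^-1 b'. *)
  have := memM (memJ (ghom p ∘ y)^-1 hx) hy.
  by rewrite /conjg !gsimp.
- by move=> T; rewrite member_pb1 fE !ghom1 !gsimp; apply: mem1.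
- move=> T x; rewrite !member_pb1 !fE !ghomV => hx.
  (* With x = (a, b): a b^-1 = a (a^-1 b)^-1 a^-1. *)
  have := memJ (ghom p ∘ x) (memV hx).
  by rewrite /conjg !gsimp.
- by exists R, i; split=> // T x; rewrite iE member_pb1 fE.
Qed.

(** The relation is the one of left cosets of [U]. The discrete fibration squares
    are pullbacks because a coset with one element in [U] is [U] itself. *)
Lemma congruence_eqrel : exists R : EqRel N,
  normal_to (Gp_limits L) u R /\
  forall (K : Gp L) (x y : hom K N),
    related (d0 R) (d1 R) x y <-> member (ghom u) ((ghom x)^-1 ⋅ ghom y).
Proof.
have [R [i [im iE]]] := congruence_subgroup.
pose r0 : @hom (Gp L) R N := gcomp p i; pose r1 : @hom (Gp L) R N := gcomp q i.
have relE (K : Gp L) (x y : hom K N) :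
    related r0 r1 x y <-> member (ghom u) ((ghom x)^-1 ⋅ ghom y).
  have -> : ghom x = ghom p ∘ ghom (gpair x y) by rewrite /= fst_pair.
  have -> : ghom y = ghom q ∘ ghom (gpair x y) by rewrite /= snd_pair.
  rewrite -iE; split=> [[k [<- <-]]|/(ghom_lift im) [k e]].
    by exists (ghom k); apply: pair_ext; rewrite /= ?fst_pair ?snd_pair comp_assoc.
  exists k; have eE : ghom i ∘ ghom k = pair L (ghom x) (ghom y) :=
    f_equal (@ghom _ _ _ _) e.
  by split; apply: ghom_eq; rewrite /= -comp_assoc eE ?fst_pair ?snd_pair.
have jm (K : Gp L) (x y : hom K R) : r0 ∘ x = r0 ∘ y -> r1 ∘ x = r1 ∘ y -> x = y.
  move=> /(f_equal (@ghom _ _ _ _)) /= e0 /(f_equal (@ghom _ _ _ _)) /= e1.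
  by apply: ghom_eq; apply: im; apply: pair_ext; rewrite !comp_assoc.
have eqv (K : Gp L) : Equivalence (@related (Gp L) R N K r0 r1).
  split=> [x|x y /relE /memV h|x y z /relE h1 /relE h2]; apply/relE.
    by rewrite mulVg; apply: mem1.
    by move: h; rewrite !gsimp.
  by have := memM h1 h2; rewrite !gsimp.
pose Q := @Build_EqRel (Gp L) N R r0 r1 jm eqv.
exists Q; split; last exact: relE.
have relU (K : Gp L) (x y : hom K U) : related r0 r1 (u ∘ x) (u ∘ y).
  apply/relE; exists ((ghom x)^-1 ⋅ ghom y).
  by rewrite ghomM ghomV.
split; first exact: mono_of_ghom.
pose l := Gp_limits L.
split.
  split; rewrite /eqrel_map.
    exists (pair l (d0 (inverse_image l u Q)) (d1 (inverse_image l u Q))).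
    by rewrite !comp_id_l; split; [apply: fst_pair | apply: snd_pair].
  rewrite !comp_id_l.
  exact: (proj2 (inv_im_related l u Q _ _) (relU _ (fst_ l U U) (snd_ l U U))).
have [u' [u0 u1]] := relU _ (fst_ l U U) (snd_ l U U).
have um' := mono_of_ghom um.
have lift (K : Gp L) (x : hom K R) (y y' : hom K U) :
    r0 ∘ x = u ∘ y -> r1 ∘ x = u ∘ y' -> u' ∘ pair l y y' = x.
  move=> e0 e1; apply/jm.
    by rewrite comp_assoc u0 -comp_assoc fst_pair.
  by rewrite comp_assoc u1 -comp_assoc snd_pair.
have relx (K : Gp L) (x : hom K R) :
    member (ghom u) ((ghom (r0 ∘ x))^-1 ⋅ ghom (r1 ∘ x)).
  by apply/relE; exists x.
have memu (K : Gp L) (y : hom K U) : member (ghom u) (ghom (u ∘ y)).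
  exact: member_comp (member_id _).
exists u'; split; split=> // K x y e; have := relx K x; rewrite e.
- move=> /(memM (memu _ y)); rewrite !gsimp => /(ghom_lift um) [y' e'].
  exists (pair l y y'); split.
    by split; [apply: lift | apply: fst_pair].
  move=> t [tx ty]; apply: esym; apply: (@pair_ext _ l); first by rewrite fst_pair.
  by rewrite snd_pair; apply: um'; rewrite [RHS]e' -tx !comp_assoc u1.
- move=> /memV /(memM (memu _ y)); rewrite !gsimp => /(ghom_lift um) [y' e'].
  exists (pair l y' y); split.
    by split; [apply: lift | apply: snd_pair].
  move=> t [tx ty]; apply: esym; apply: (@pair_ext _ l); last by rewrite snd_pair.
  by rewrite fst_pair; apply: um'; rewrite [RHS]e' -tx !comp_assoc u0.
Qed.

End Congruence.

(** * The normalizer *)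

Section Normalizer.
Variables (X : Exponentials L) (U G : Group L) (v : GroupHom U G).
Hypothesis vm : mono (ghom v).

(** Both inclusions are required, as [a U a^-1 ⊆ U] alone may fail for
    [a^-1] when [U] is infinite; [x] lives at a later stage than [a]. *)
Definition normalizes (T : E) (a : hom T (gcarr G)) : Prop :=
  forall (T' : E) (s : hom T' T) (x : hom T' (gcarr U)),
    member (ghom v) (conjg (a ∘ s) (ghom v ∘ x)) /\
    member (ghom v) (conjg (a ∘ s)^-1 (ghom v ∘ x)).

Lemma normalizer_subgroup : exists (N : Group L) (w : GroupHom N G), mono (ghom w) /\
  forall (T : E) (a : hom T (gcarr G)), member (ghom w) a <-> normalizes a.
Proof.
(* Both conditions at once: (a, x) ↦ (a x a^-1, a^-1 x a) has to land in U × U. *)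
pose c := conjg (fst_ L (gcarr G) (gcarr U)) (ghom v ∘ snd_ L _ _).
pose c' := conjg (fst_ L (gcarr G) (gcarr U))^-1 (ghom v ∘ snd_ L _ _).
have [N [n [nm nE]]] := forall_representable X (pair L c c') (mono_prod_map vm vm).
have memN (T : E) (a : hom T (gcarr G)) : member n a <-> normalizes a.
  have fE T' (s : hom T' T) x :
      member (prod_map L (ghom v) (ghom v)) (pair L c c' ∘ pair L (a ∘ s) x) <->
      member (ghom v) (conjg (a ∘ s) (ghom v ∘ x)) /\
      member (ghom v) (conjg (a ∘ s)^-1 (ghom v ∘ x)).
    rewrite pair_comp member_prod_map /c /c' !conjg_comp invg_comp -comp_assoc.
    by rewrite fst_pair snd_pair.
  by rewrite nE; split=> h T' s x; apply/fE; apply: h.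
have [|||H [i [im iE]]] := @subgroup_of_mono G N n nm.
- move=> T a b; rewrite !memN => ha hb T' s x; rewrite !mulg_comp.
  (* y = b x b^-1 gives (ab) x (ab)^-1 = a y a^-1; z = a^-1 x a, the inverse. *)
  have [[y yE] _] := hb _ s x; have [y1 _] := ha _ s y.
  have [_ [z zE]] := ha _ s x; have [_ z1] := hb _ s z.
  by move: y1 z1; rewrite yE zE /conjg !gsimp.
- move=> T; rewrite memN => T' s x; rewrite oneg_comp /conjg !gsimp.
  by split; exists x.
- move=> T a; rewrite !memN => ha T' s x; rewrite invg_comp.
  by have [h1 h2] := ha _ s x; rewrite [in X in _ /\ X]invgK.
- by exists H, i; split=> // T a; rewrite iE memN.
Qed.

End Normalizer.
End GroupElements.

Theorem proposition2p2 (E : Category) (L : FiniteLimits E) (X : Exponentials L) :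
  has_normalizers (Gp_limits L).
Proof.
move=> U G v /mono_ghom vm.
have [N [w [wm wE]]] := normalizer_subgroup X vm.
(* U normalizes itself, so v factors as w ∘ u with u : U → N. *)
have nv : normalizes v (ghom v).
  move=> T s x.
  split; [exists (conjg s x) | exists (conjg (invg s) x)]; by rewrite ghomJ ?ghomV.
have [u uE] := ghom_lift wm (proj2 (wE _ _) nv).
have uG : ghom w ∘ ghom u = ghom v := f_equal (@ghom _ _ _ _) uE.
have um : mono (ghom u).
  by move=> T x y e; apply: vm; rewrite -uG -!comp_assoc e.
have uJ T (a : hom T (gcarr N)) (x : hom T (gcarr U)) :
    member (ghom u) (conjg a (ghom u ∘ x)).
  have /wE /(_ T (idm T) x) [] : member (ghom w) (ghom w ∘ a) by exists a.
  rewrite comp_id_r => -[y yE] _; exists y; apply: wm.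
  by rewrite ghomJ !(comp_assoc (ghom w)) uG.
have [R [uR RE]] := congruence_eqrel um uJ.
exists N, u, R, w; split=> //; split; first by rewrite -uE.
move=> X' S u' h nu' vE.
have hE : ghom h ∘ ghom u' = ghom v := esym (f_equal (@ghom _ _ _ _) vE).
have nh : normalizes v (ghom h).
  have hJ T (a : hom T (gcarr X')) (x : hom T (gcarr U)) :
      member (ghom v) (conjg (ghom h ∘ a) (ghom v ∘ x)).
    have [y yE] := normal_conj nu' a x; exists y.
    by rewrite -hE -comp_assoc yE ghomJ comp_assoc.
  by move=> T s x; rewrite -ghomV; split; apply: hJ.
have [h' h'E] := ghom_lift wm (proj2 (wE _ _) nh).
have h'G : ghom w ∘ ghom h' = ghom h := f_equal (@ghom _ _ _ _) h'E.
have h'u : gcomp h' u' = u.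
  by apply: ghom_eq; apply: wm; rewrite /= comp_assoc h'G hE uG.
have h'uG : ghom h' ∘ ghom u' = ghom u := f_equal (@ghom _ _ _ _) h'u.
exists h'; split; last first.
  move=> k [kE _]; apply: (mono_of_ghom wm); exact: (etrans h'E (esym kE)).
split=> //; split=> //.
(* The generic pair (d0, d1) of S has d0^-1 d1 in U, and h' preserves this. *)
apply/RE; have [z] := normal_div nu' (idm _).
rewrite !comp_id_r => zE; exists z.
by rewrite -h'uG -comp_assoc zE ghomM ghomV.
Qed.
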